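(* Let $R$ be a commutative ring with identity and let $\mathcal{GP}$ be the class of Gorenstein projective $R$-modules. Assume that every $R$-module in ${}^{\bot}(\mathcal{GP}^{\bot})$ has a Gorenstein projective precover (this is the case if, for instance, the class $\mathcal{GP}$ is precovering). Then $\mathcal{GP}$ coincides with the class of $\mathcal{GP}$-pure projective $R$-modules.
   Context: An $R$-module $M$ is Gorenstein projective if there is an exact complex $\mathbf{P}=\cdots\to P_1\to P_0\to P_{-1}\to\cdots$ of projective $R$-modules such that $\operatorname{Hom}_R(\mathbf{P},Q)$ is exact for every projective $R$-module $Q$ and $M\cong\operatorname{im}(P_0\to P_{-1})$. For a class $\mathscr{X}$ of $R$-modules, $\mathscr{X}^{\bot}$ is the class of $R$-modules $M$ with $\operatorname{Ext}^1_R(X,M)=0$ for all $X\in\mathscr{X}$, and ${}^{\bot}\mathscr{X}$ is the class of $R$-modules $M$ with $\operatorname{Ext}^1_R(M,X)=0$ for all $X\in\mathscr{X}$. An $\mathscr{X}$-precover of an $R$-module $M$ is a homomorphism $\varphi:X\to M$ with $X\in\mathscr{X}$ such that $\operatorname{Hom}_R(X',X)\to\operatorname{Hom}_R(X',M)$ is surjective for every $X'\in\mathscr{X}$. The class $\mathscr{X}$ is precovering if every $R$-module has an $\mathscr{X}$-precover. A Gorenstein projective precover is a $\mathcal{GP}$-precover. A short exact sequence $0\to A\to B\to C\to 0$ of $R$-modules is $\mathscr{X}$-pure exact if $\operatorname{Hom}_R(U,B)\to\operatorname{Hom}_R(U,C)$ is surjective for every $U\in\mathscr{X}$. An $R$-module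 $M$ is $\mathscr{X}$-pure projective if $\operatorname{Hom}_R(M,-)$ leaves every $\mathscr{X}$-pure exact sequence exact. *)

(* Defs.v *)
From HB Require Import structures.
From mathcomp Require Import all_boot all_order all_algebra.
Set Implicit Arguments.
Unset Strict Implicit.
Unset Printing Implicit Defensive.
Import GRing.Theory.
Local Open Scope ring_scope.

Section Modules.
Variable R : comPzRingType.

Definition surjective_map (A B : Type) (f : A -> B) : Prop :=
  forall y, exists x, f x = y.

(* A --f--> B --g--> C is exact at B; in particular g \o f = 0. *)
Definition exact_at (A B C : lmodType R)
    (f : {linear A -> B}) (g : {linear B -> C}) : Prop :=
  forall y : B, g y = 0 <-> exists x : A, f x = y.

Definition short_exact (A B C : lmodType R)
    (i : {linear A -> B}) (p : {linear B -> C}) : Prop :=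
  [/\ injective i, exact_at i p & surjective_map p].

(* Hom_R(C, Q) -> Hom_R(B, Q) -> Hom_R(A, Q), obtained from
   A --f--> B --g--> C, is exact at Hom_R(B, Q). *)
Definition contra_hom_exact_at (A B C Q : lmodType R)
    (f : {linear A -> B}) (g : {linear B -> C}) : Prop :=
  forall h : {linear B -> Q},
    h \o f =1 (fun=> 0) <-> exists k : {linear C -> Q}, k \o g =1 h.

(* Hom_R(U, B) -> Hom_R(U, C) is surjective. *)
Definition hom_surjective (U B C : lmodType R) (p : {linear B -> C}) : Prop :=
  forall f : {linear U -> C}, exists g : {linear U -> B}, p \o g =1 f.

(* 0 -> Hom_R(M, A) -> Hom_R(M, B) -> Hom_R(M, C) -> 0 is exact. *)
Definition hom_short_exact (M A B C : lmodType R)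
    (i : {linear A -> B}) (p : {linear B -> C}) : Prop :=
  [/\ forall f f' : {linear M -> A}, i \o f =1 i \o f' -> f =1 f',
      forall g : {linear M -> B},
        p \o g =1 (fun=> 0) <-> exists f : {linear M -> A}, i \o f =1 g
    & hom_surjective M p].

Definition projective (P : lmodType R) : Prop :=
  forall (B C : lmodType R) (p : {linear B -> C}),
    surjective_map p -> hom_surjective P p.

(* ... -> P 2 -> P 1 -> P 0 -> M -> 0 *)
Definition projective_resolution (M : lmodType R) (P : nat -> lmodType R)
    (d : forall n, {linear P n.+1 -> P n}) (e : {linear P 0%N -> M}) : Prop :=
  [/\ forall n, projective (P n),
      forall n, exact_at (d n.+1) (d n),
      exact_at (d 0%N) e
    & surjective_map e].

(* Ext^1_R(M, N) is the first cohomology of Hom_R(P, N) for a projective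
   resolution P of M, and does not depend on P. It vanishes when Hom_R(P, N)
   is exact at Hom_R(P 1, N). *)
Definition Ext1_vanishes (M N : lmodType R) : Prop :=
  exists (P : nat -> lmodType R) (d : forall n, {linear P n.+1 -> P n})
         (e : {linear P 0%N -> M}),
    projective_resolution d e /\ contra_hom_exact_at N (d 1%N) (d 0%N).

(* A complex over the integers is indexed by the target of its differentials,
   d i : P (i + 1) -> P i, so that composites typecheck without casts;
   P_0 -> P_{-1} is d (-1). The isomorphism of M with im (d (-1)) is given as
   an injective map j from M into P (-1) with the same image as d (-1). *)
Definition Gorenstein_projective (M : lmodType R) : Prop :=
  exists (P : int -> lmodType R) (d : forall i, {linear P (i + 1) -> P i}),
    [/\ forall i, projective (P i),
        forall i, exact_at (d (i + 1)) (d i),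
        forall Q : lmodType R, projective Q ->
          forall i, contra_hom_exact_at Q (d (i + 1)) (d i)
      & exists j : {linear M -> P (-1)}, injective j /\
          forall y, (exists m, j m = y) <-> (exists x, d (-1) x = y)].

Definition right_orth (X : lmodType R -> Prop) (M : lmodType R) : Prop :=
  forall U, X U -> Ext1_vanishes U M.

Definition left_orth (X : lmodType R -> Prop) (M : lmodType R) : Prop :=
  forall U, X U -> Ext1_vanishes M U.

Definition is_precover (X : lmodType R -> Prop) (U M : lmodType R)
    (phi : {linear U -> M}) : Prop :=
  X U /\ forall U', X U' -> hom_surjective U' phi.

Definition has_precover (X : lmodType R -> Prop) (M : lmodType R) : Prop :=
  exists (U : lmodType R) (phi : {linear U -> M}), is_precover X phi.

Definition precovering (X : lmodType R -> Prop) : Prop :=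
  forall M, has_precover X M.

Definition pure_exact (X : lmodType R -> Prop) (A B C : lmodType R)
    (i : {linear A -> B}) (p : {linear B -> C}) : Prop :=
  short_exact i p /\ forall U, X U -> hom_surjective U p.

Definition pure_projective (X : lmodType R -> Prop) (M : lmodType R) : Prop :=
  forall (A B C : lmodType R) (i : {linear A -> B}) (p : {linear B -> C}),
    pure_exact X i p -> hom_short_exact M i p.

End Modules.

(* Main.v *)
Require Import Defs.
From HB Require Import structures.
From mathcomp Require Import all_boot all_order all_algebra.
From mathcomp Require Import ring_quotient boolp functions.
Set Implicit Arguments.
Unset Strict Implicit.
Unset Printing Implicit Defensive.
Import GRing.Theory.
Local Open Scope ring_scope.
Local Open Scope quotient_scope.

(* If M is GP-pure projective and N lies in the right orthogonal of GP, every
   extension of M by N is GP-pure, hence split; so M lies in the double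
   orthogonal and has a GP-precover, which is onto because free modules lie in
   GP. This epimorphism is GP-pure, hence split, and M is a retract of a
   Gorenstein projective module.

   That GP is closed under retracts is seen by closing GP under both extensions
   and retracts. If M is a retract of E by s and r, and 0 -> E -> P -> E' -> 0
   is exact with P projective, then C = P / s(M) is a retract of C + M, which is
   an extension of E' by E; dually for syzygies. So every module of the closure
   has a syzygy and a cosyzygy in the closure, and Ext^1 from the closure to
   projectives vanishes: splicing produces a complete resolution. *)

(** * Linear maps, submodules and quotient modules *)

Section LinearMaps.
Variable R : comPzRingType.
Implicit Types A B C X Y Z : lmodType R.

Lemma linear_map_exists A B (f : A -> B) :
  linear f -> exists g : {linear A -> B}, g =1 f.
Proof.
move=> fL.
pose mf := GRing.isLinear.Build R A B *:%R f fL.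
pose g : {linear A -> B} := HB.pack f mf.
by exists g.
Qed.

(** For any set-theoretic section [t] of [s], the composite [h \o t] is linear, because [h] does not
    see the choice made inside a fibre of [s]. *)
Lemma factor_surjective X Y Z (s : {linear X -> Y}) (h : {linear X -> Z}) :
    surjective_map s -> (forall x, s x = 0 -> h x = 0) ->
  exists k : {linear Y -> Z}, forall x, k (s x) = h x.
Proof.
move=> sS sh; have [t tK] := choice sS.
have htE x : h (t (s x)) = h x.
  by apply/eqP; rewrite -subr_eq0 -linearB; apply/eqP/sh; rewrite linearB tK subrr.
have [a u v|k kE] := @linear_map_exists _ _ (h \o t).
  by rewrite /= -linearP -(htE (a *: t u + t v)) linearP !tK.
by exists k => x; rewrite kE /= htE.
Qed.

Lemma factor_injective X A B (i : {linear A -> B}) (h : {linear X -> B}) :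
    injective i -> (forall x, exists a, i a = h x) ->
  exists k : {linear X -> A}, forall x, i (k x) = h x.
Proof.
move=> iI /choice[t tK].
have [a u v|k kE] := @linear_map_exists _ _ t.
  by apply: iI; rewrite linearP !tK linearP.
by exists k => x; rewrite kE.
Qed.

Section Submodule.
Variables (B : lmodType R) (S : B -> Prop).
Hypotheses (S0 : S 0) (SP : forall a u v, S u -> S v -> S (a *: u + v)).

Let Sp : {pred B} := fun x => `[< S x >].

Fact submod_pred_closed : GRing.subsemimod_closed Sp.
Proof.
split; first split.
- exact/asboolP.
- by move=> u v /asboolP Su /asboolP Sv; apply/asboolP; rewrite -[u]scale1r; apply: SP.
- by move=> a u /asboolP Su; apply/asboolP; rewrite -[_ *: _]addr0; apply: SP.
Qed.

Lemma submodule_exists :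
  exists (A : lmodType R) (i : {linear A -> B}),
    injective i /\ forall y, (exists x, i x = y) <-> S y.
Proof.
pose cl := GRing.isSubmodClosed.Build R B Sp submod_pred_closed.
pose Sc : submodClosed B := HB.pack Sp cl.
pose T := {x : B | Sp x}.
pose m := GRing.SubChoice_isSubLmodule.Build R B Sp T (GRing.subsemimodClosedP Sc).
pose A : lmodType R := HB.pack T m.
have [a u v|i iE] := @linear_map_exists A B (fun x : A => val (x : T)).
  by [].
exists A, i; split=> [x y|y].
  by rewrite !iE => /val_inj.
split=> [[x <-]|/asboolP Sy].
  by rewrite iE; apply/asboolP/(valP (x : T)).
by exists (exist _ y Sy : T); rewrite iE.
Qed.
End Submodule.

Lemma kernel_exists B C (g : {linear B -> C}) :
  exists (A : lmodType R) (i : {linear A -> B}), injective i /\ exact_at i g.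
Proof.
have [||A [i [iI iE]]] := @submodule_exists B (fun x => g x = 0).
- exact: linear0.
- by move=> a u v gu gv; rewrite linearP gu gv scaler0 addr0.
by exists A, i; split=> // y; rewrite iE.
Qed.

Lemma cokernel_exists A B (f : {linear A -> B}) :
  exists (C : lmodType R) (g : {linear B -> C}), exact_at f g /\ surjective_map g.
Proof.
pose S : {pred B} := fun y => `[< exists x, f x = y >].
have Scl : zmod_closed S.
  split; first by apply/asboolP; exists 0; rewrite linear0.
  move=> u v /asboolP[x <-] /asboolP[y <-]; apply/asboolP; exists (x - y).
  by rewrite linearB.
pose mI := GRing.isZmodClosed.Build B S Scl.
pose I : zmodClosed B := HB.pack S mI.
(* [Q] is the quotient as an additive group; the scalar action is built next on representatives, and
   is well defined because the image of [f] is stable under scaling. *)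
pose Q := {ideal_quot I}.
have piD x y : \pi_Q (x + y) = \pi_Q x + \pi_Q y := raddfD _ x y.
have pi_eq x y : (exists a, f a = x - y) <-> x = y %[mod Q].
  by split=> [xy|/eqP]; [apply/eqP|]; rewrite -Quotient.idealrBE; [apply/asboolP|move/asboolP].
have [scale scaleE] : exists scale : R -> Q -> Q,
    forall a x, scale a (\pi_Q x) = \pi_Q (a *: x).
  exists (fun a x => \pi_Q (a *: repr x)) => a x.
  have [z zE] : exists z, f z = repr (\pi_Q x) - x by apply/pi_eq; rewrite reprK.
  by apply/pi_eq; exists (a *: z); rewrite linearZ /= zE scalerBr.
have s1 a b v : scale a (scale b v) = scale (a * b) v.
  by rewrite -[v]reprK !scaleE scalerA.
have s2 : left_id 1 scale by move=> v; rewrite -[v]reprK scaleE scale1r.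
have s3 : right_distributive scale +%R.
  by move=> a u v; rewrite -[u]reprK -[v]reprK -piD !scaleE scalerDr piD.
have s4 v : {morph scale^~ v : a b / a + b}.
  by move=> a b; rewrite -[v]reprK !scaleE scalerDl piD.
pose mC := GRing.Zmodule_isLmodule.Build R Q s1 s2 s3 s4.
pose C : lmodType R := HB.pack Q mC.
have [a u v|g gE] := @linear_map_exists B C (fun x => \pi_Q x).
  by rewrite piD -scaleE.
exists C, g; split=> y; last by exists (repr (y : Q)); rewrite gE reprK.
rewrite gE -[0]/(0 : Q) -(raddf0 \pi_Q).
by rewrite -pi_eq subr0.
Qed.

End LinearMaps.

(** * Free modules and enough projectives *)

Section FreeModules.
Variable R : comPzRingType.

(** [F] consists of the finitely supported functions from [X] to [R], with the indicator functions
    as basis. The two clauses are the existence and uniqueness halves of the universal property. *)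
Lemma free_module_exists (X : eqType) :
  exists (F : lmodType R) (delta : X -> F),
    (forall (B : lmodType R) (b : X -> B),
       exists g : {linear F -> B}, forall x, g (delta x) = b x) /\
    (forall (B : lmodType R) (g h : {linear F -> B}),
       (forall x, g (delta x) = h (delta x)) -> g =1 h).
Proof.
pose V : lmodType R := (X -> R^o).
pose supp (s : seq X) (f : V) := forall x, x \notin s -> f x = 0.
have [||F [i [iI iE]]] := @submodule_exists R V (fun f => exists s, supp s f).
- by exists [::] => x.
- move=> a f g [s fs] [t gt]; exists (s ++ t) => x.
  rewrite mem_cat negb_or => /andP[xs xt].
  by rewrite addrfctE scalrfctE fs ?gt ?scaler0 ?addr0.
have fin f : exists s, supp s (i f) by apply/iE; exists f.
have /choice[delta deltaE] : forall x, exists d : F, i d = (fun y => (y == x)%:R).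
  by move=> x; apply/iE; exists [:: x] => y; rewrite inE => /negbTE->.
have [S SE] := choice fin.
(* The sum uses a chosen support [S f]. Linearity compares different supports, so [evE] first shows
   that every duplicate-free support gives the same sum, by discarding zero coefficients. *)
pose ev (B : lmodType R) (b : X -> B) f := \sum_(x <- undup (S f)) i f x *: b x.
have evE B b f s : uniq s -> supp s (i f) ->
    @ev B b f = \sum_(x <- s) i f x *: b x.
  move=> sU sf.
  have nz t : uniq t -> \sum_(x <- t) i f x *: b x =
      \sum_(x <- [seq y <- t | i f y != 0]) i f x *: b x.
    move=> tU; rewrite [RHS]big_filter [RHS]big_mkcond; apply: eq_bigr => x _.
    by case: eqP => [->|] //; rewrite scale0r.
  rewrite /ev nz ?undup_uniq // [RHS]nz //; apply: perm_big.
  apply: uniq_perm; rewrite ?filter_uniq ?undup_uniq // => x.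
  rewrite !mem_filter mem_undup; case: eqP => //= /eqP fx.
  have -> : x \in s by apply: contraNT fx => /sf->.
  by apply: contraNT fx => /SE->.
have evD B b : linear (@ev B b).
  move=> a f g; pose s := undup (S f ++ S g).
  have sf : supp s (i f).
    by move=> x; rewrite mem_undup mem_cat negb_or => /andP[/SE].
  have sg : supp s (i g).
    by move=> x; rewrite mem_undup mem_cat negb_or => /andP[_ /SE].
  have sfg : supp s (i (a *: f + g)).
    by move=> x xs; rewrite linearP addrfctE scalrfctE sf ?sg ?scaler0 ?addr0.
  rewrite !(evE _ _ _ s) ?undup_uniq // scaler_sumr -big_split /=.
  apply: eq_bigr => x _; rewrite linearP addrfctE scalrfctE scalerDl.
  by rewrite scalerA.
exists F, delta; split=> [B b|B g h gh f].
  have [g gE] := linear_map_exists (@evD B b).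
  exists g => x; rewrite gE (evE _ _ _ [:: x]) // => [|y].
    by rewrite big_seq1 deltaE eqxx scale1r.
  by rewrite inE deltaE => /negbTE->.
(* Evaluating at the basis itself expands [f] in that basis, so two linear maps agreeing on [delta]
   agree on [f]. *)
have -> : f = ev _ delta f.
  apply: iI; rewrite linear_sum; apply: funext => x.
  rewrite fct_sumE /=.
  under eq_bigr do rewrite linearZ /= deltaE scalrfctE.
  have [xS|xS] := boolP (x \in undup (S f)).
    rewrite (bigD1_seq x) ?undup_uniq //= eqxx big1 ?addr0 => [|y /negbTE].
      by rewrite [_ *: _]mulr1.
    by rewrite eq_sym => ->; rewrite scaler0.
  rewrite big_seq big1 => [|y yS]; first by apply: SE; rewrite -mem_undup.
  by case: eqP xS yS => [->|_ _ _]; [move/negbTE-> | rewrite scaler0].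
by rewrite !linear_sum; apply: eq_bigr => x _; rewrite !linearZ /= gh.
Qed.

Lemma projective_epi_exists (M : lmodType R) :
  exists (F : lmodType R) (e : {linear F -> M}), projective F /\ surjective_map e.
Proof.
have [F [delta [Fex Funi]]] := free_module_exists M.
have [e eE] := Fex M id.
exists F, e; split=> [B C p pS f|y]; last by exists (delta y).
have [t tE] := choice pS.
have [g gE] := Fex B (fun x => t (f (delta x))).
by exists g; apply: (Funi _ (p \o g)) => x; rewrite /= gE tE.
Qed.

End FreeModules.

(** * Vanishing of Ext as extension of maps *)

Section ExtensionProperty.
Variable R : comPzRingType.
Implicit Types A B C E F G M N P Q U : lmodType R.

Lemma linear_pair_exists A B C (f : {linear A -> B}) (g : {linear A -> C}) :
  exists h : {linear A -> (B * C)%type}, forall x, h x = (f x, g x).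
Proof. by apply: linear_map_exists => a u v /=; rewrite !linearP. Qed.

(** Realised as the kernel of [p - q] on [B * C]. The elementwise clauses serve diagram chases, the
    last one the construction of maps into the pullback. *)
Lemma pullback_exists B C M (p : {linear B -> M}) (q : {linear C -> M}) :
  exists (P : lmodType R) (b : {linear P -> B}) (c : {linear P -> C}),
    [/\ forall z, p (b z) = q (c z),
        forall z z', b z = b z' -> c z = c z' -> z = z',
        forall x y, p x = q y -> exists z, b z = x /\ c z = y
      & forall (X : lmodType R) (u : {linear X -> B}) (v : {linear X -> C}),
          (forall x, p (u x) = q (v x)) ->
        exists w : {linear X -> P}, forall x, b (w x) = u x /\ c (w x) = v x].
Proof.
have [P [k [kI kE]]] := kernel_exists ((p \o fst) \- (q \o snd)).
have kex x y : p x = q y -> exists z, k z = (x, y).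
  by move=> xy; apply/kE; rewrite /= xy subrr.
exists P, (fst \o k), (snd \o k); split=> [z|z z' /= z1 z2|x y xy|X u v uv].
- by apply/eqP; rewrite -subr_eq0; apply/eqP/(kE (k z)); exists z.
- by apply: kI; rewrite [k z]surjective_pairing z1 z2 -surjective_pairing.
- by have [z zE] := kex _ _ xy; exists z; rewrite /= zE.
have [h hE] := linear_pair_exists u v.
have [|w wE] := factor_injective (h := h) kI.
  by move=> x; rewrite hE; apply: kex.
by exists w => x; rewrite /= wE hE.
Qed.

(* This is Ext^1_R(M, N) = 0 in the form that is stable under extensions,
   retracts and base change without recourse to resolutions. *)
Definition extension_property M N : Prop :=
  forall A B (i : {linear A -> B}) (p : {linear B -> M}), short_exact i p ->
  forall f : {linear A -> N}, exists g : {linear B -> N}, forall x, g (i x) = f x.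

(** Lifting [e] through [p] gives [l] on [F0] and [k : F1 -> A]. Then [f \o k] is a cocycle, so it
    equals [h \o d0] for some [h]. As [B] is the quotient of [A * F0] by the pairs [(- k y, d0 y)],
    the map [f + h] descends to [B]. *)
Lemma extension_property_presentation M N F2 F1 F0
    (d1 : {linear F2 -> F1}) (d0 : {linear F1 -> F0}) (e : {linear F0 -> M}) :
    projective F0 -> surjective_map e -> exact_at d0 e ->
    (forall x, d0 (d1 x) = 0) -> contra_hom_exact_at N d1 d0 ->
  extension_property M N.
Proof.
move=> pF eS eE dd dN A B i p [iI iE pS] f.
have [l lE] := pF _ _ p pS e.
have [k kE] : exists k : {linear F1 -> A}, forall x, i (k x) = l (d0 x).
  apply: (factor_injective (h := l \o d0)) => // x; apply/iE.
  by rewrite [p _]lE; apply/eE; exists x.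
have [h hE] : exists h : {linear F0 -> N}, h \o d0 =1 f \o k.
  apply/dN => x /=; suff -> : k (d1 x) = 0 by rewrite linear0.
  by apply: iI; rewrite kE dd !linear0.
pose s : {linear (A * F0)%type -> B} := (i \o fst) \+ (l \o snd).
pose t : {linear (A * F0)%type -> N} := (f \o fst) \+ (h \o snd).
have [||g gE] := factor_surjective (s := s) (h := t).
- move=> b; have [x xE] := eS (p b).
  have [|a aE] := (iE (b - l x)).1.
    by rewrite linearB [p (l _)]lE xE subrr.
  by exists (a, x); rewrite /= aE subrK.
- move=> [a x] /= sax.
  have [|y yx] := (eE x).1.
    by rewrite -[e x]lE /= -[l x](addKr (i a)) sax addr0 linearN (iE _).2 ?oppr0 //; exists a.
  have -> : a = - k y.
    by apply: iI; rewrite linearN kE yx; apply/eqP; rewrite -addr_eq0 sax.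
  by rewrite -yx [h _]hE /= linearN addNr.
by exists g => a; have := gE (a, 0); rewrite /= !linear0 !addr0.
Qed.

(** Let [D] be the preimage of [A] in [L]. The map [f] extends from [K] to [D], with quotient [A],
    and then from [D] to [L], with quotient [B]. *)
Lemma extension_property_ext A E B N (i : {linear A -> E}) (p : {linear E -> B}) :
    short_exact i p -> extension_property A N -> extension_property B N ->
  extension_property E N.
Proof.
move=> [iI iE pS] eA eB K L j q [jI jE qS] f.
have [D [k [kI kE]]] := kernel_exists (p \o q).
have [j' j'E] : exists j' : {linear K -> D}, forall x, k (j' x) = j x.
  apply: factor_injective => // x; apply/kE => /=.
  by rewrite (jE _).2 ?linear0 //; exists x.
have [q' q'E] : exists q' : {linear D -> A}, forall x, i (q' x) = q (k x).
  by apply: (factor_injective (h := q \o k)) => // x; apply/iE/kE; exists x.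
have [|g gE] := eA _ _ j' q' _ f.
  split=> [x y xy|y|a].
  - by apply: jI; rewrite -!j'E xy.
  - split=> [y0|[x <-]].
      have [|x xE] := (jE (k y)).1; first by rewrite -q'E y0 linear0.
      by exists x; apply: kI; rewrite j'E.
    by apply: iI; rewrite q'E j'E linear0; apply/jE; exists x.
  have [b bE] := qS (i a).
  have [|d dE] := (kE b).1; first by rewrite /= bE; apply/iE; exists a.
  by exists d; apply: iI; rewrite q'E dE.
have [|h hE] := eB _ _ k (p \o q) _ g.
  split=> // y; have [x <-] := pS y; have [z <-] := qS x.
  by exists z.
by exists h => x; rewrite -j'E hE.
Qed.

(** Pulling the extension back along [r] gives an extension of [E] by [A], to which [f] extends.
    Since [r \o s] is the identity, [B] maps to the pullback by [(id, s \o p)], compatibly with the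
    copies of [A]. *)
Lemma extension_property_retract M E N (s : {linear M -> E}) (r : {linear E -> M}) :
  cancel s r -> extension_property E N -> extension_property M N.
Proof.
move=> sK eE A B i p [iI iE pS] f.
have [P [b [c [bc bcI bcE bcU]]]] := pullback_exists p r.
have [|i' i'E] := bcU _ i (GRing.null_fun E : {linear A -> E}).
  by move=> x; rewrite linear0; apply/iE; exists x.
have [|g gE] := eE _ _ i' c _ f.
  split=> [x y xy|y|y].
  - by apply: iI; rewrite -!(i'E _).1 xy.
  - split=> [y0|[x <-]]; last exact: (i'E x).2.
    have [|x xE] := (iE (b y)).1; first by rewrite bc y0 linear0.
    by exists x; apply: bcI; [rewrite (i'E x).1 xE | rewrite (i'E x).2 y0].
  have [x xE] := pS (r y); have [z [_ zE]] := bcE _ _ xE.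
  by exists z.
have [|h hE] := bcU _ idfun (s \o p); first by move=> x; rewrite /= sK.
exists (g \o h) => x; rewrite -gE /=; congr (g _).
have px : p (i x) = 0 by apply/iE; exists x.
apply: bcI; first by rewrite (hE _).1 (i'E _).1.
by rewrite (hE _).2 (i'E _).2 /= px linear0.
Qed.

Lemma Ext1_vanishes_extension M N : Ext1_vanishes M N -> extension_property M N.
Proof.
move=> [P [d [e [[pP dE eE eS] dN]]]].
apply: (extension_property_presentation (pP 0%N) eS eE _ dN) => x.
by apply/dE; exists x.
Qed.

(** The pullback along [u] is an extension of [U] by [N], and the identity of [N] extends to a
    retraction [rho]. Then [b - i \o rho] kills the kernel of [c] and descends to a lift of [u]. *)
Lemma extension_property_hom_surjective U N B M (i : {linear N -> B}) (p : {linear B -> M}) :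
  short_exact i p -> extension_property U N -> hom_surjective U p.
Proof.
move=> [iI iE pS] eU u.
have [P [b [c [bc bcI bcE bcU]]]] := pullback_exists p u.
have pi0 x : p (i x) = 0 by apply/iE; exists x.
have [|i' i'E] := bcU _ i (GRing.null_fun U : {linear N -> U}).
  by move=> x; rewrite pi0 linear0.
have kerc z : c z = 0 -> exists x, i' x = z.
  move=> z0; have [|x xE] := (iE (b z)).1; first by rewrite bc z0 linear0.
  by exists x; apply: bcI; [rewrite (i'E x).1 | rewrite (i'E x).2].
have cS : surjective_map c.
  move=> y; have [x xE] := pS (u y); have [z [_ zE]] := bcE _ _ xE.
  by exists z.
have [|rho rhoE] := eU _ _ i' c _ idfun.
  split=> [x y xy||//]; first by apply: iI; rewrite -!(i'E _).1 xy.
  by move=> z; split=> [/kerc|[x <-]] //; exact: (i'E x).2.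
have [|g gE] := factor_surjective (h := b \- (i \o rho)) cS.
  by move=> z /kerc[x <-]; rewrite /= rhoE (i'E x).1 subrr.
exists g => x; have [z <-] := cS x.
by rewrite /= gE /= linearB pi0 subr0 bc.
Qed.

End ExtensionProperty.

(** * Syzygies and cosyzygies of extensions and retracts *)

Section Syzygies.
Variable R : comPzRingType.
Implicit Types A B C E F G M N P Q U : lmodType R.

Lemma linear_injective A B (f : {linear A -> B}) :
  (forall x, f x = 0 -> x = 0) -> injective f.
Proof. exact: raddf_inj. Qed.

Definition syzygy_of M N : Prop :=
  exists (P : lmodType R) (i : {linear M -> P}) (p : {linear P -> N}),
    projective P /\ short_exact i p.

Lemma projective_prod P Q : projective P -> projective Q -> projective (P * Q)%type.
Proof.
move=> pP pQ B C p pS f.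
have [u uE] := linear_pair_exists idfun (GRing.null_fun Q : {linear P -> Q}).
have [v vE] := linear_pair_exists (GRing.null_fun P : {linear Q -> P}) idfun.
have [g gE] := pP _ _ p pS (f \o u).
have [h hE] := pQ _ _ p pS (f \o v).
exists ((g \o fst) \+ (h \o snd)) => -[x y] /=.
rewrite linearD [p (g x)]gE [p (h y)]hE /= uE vE -linearD /=.
by congr (f (_, _)); rewrite ?addr0 ?add0r.
Qed.

(** Dual horseshoe: the vanishing of Ext from [B] to projectives stands in for injectivity of [P],
    extending [f] to [al] on [E]. Then [(al, f' \o p)] embeds [E] in [P * P'], with cokernel
    [E']. *)
Lemma cosyzygy_horseshoe A E B A' B' (i : {linear A -> E}) (p : {linear E -> B}) :
    short_exact i p -> (forall Q, projective Q -> extension_property B Q) ->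
    syzygy_of A A' -> syzygy_of B B' ->
  exists E' (i' : {linear A' -> E'}) (p' : {linear E' -> B'}),
    short_exact i' p' /\ syzygy_of E E'.
Proof.
move=> ip eB [P [f [pi [pP [fI fE piS]]]]] [P' [f' [pi' [pP' [fI' fE' piS']]]]].
have [al alE] := eB _ pP _ _ _ _ ip f; case: ip => [iI iE pS].
have [h hE] := linear_pair_exists al (f' \o p).
have [E' [q [qE qS]]] := cokernel_exists h.
have [u uE] := linear_pair_exists idfun (GRing.null_fun P' : {linear P -> P'}).
have [|i' i'E] := factor_surjective (h := q \o u) piS.
  move=> x /fE[a <-]; apply/qE; exists (i a); rewrite hE uE /= alE.
  by congr (_, _); rewrite (iE _).2 ?linear0 //; exists a.
have [|p' p'E] := factor_surjective (h := pi' \o snd) qS.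
  by move=> x /qE[e <-]; rewrite hE /=; apply/fE'; exists (p e).
exists E', i', p'; split; last first.
  exists (P * P')%type, h, q; split; first exact: projective_prod.
  split=> // e e'; rewrite !hE => -[ee /fI' pe].
  have [|a aE] := (iE (e - e')).1; first by rewrite linearB pe subrr.
  apply/eqP; rewrite -subr_eq0 -aE; apply/eqP.
  suff -> : a = 0 by rewrite linear0.
  by apply: fI; rewrite -alE aE linear0 linearB ee subrr.
split=> [|y|y].
- apply: linear_injective => x; have [z <-] := piS x.
  rewrite i'E /= => /qE[e]; rewrite hE uE => -[ez pe].
  have [|a aE] := (iE e).1; first by apply: fI'; rewrite pe linear0.
  by apply/fE; exists a; rewrite -alE aE.
- have [[x z] <-] := qS y; rewrite p'E /=; split=> [/fE'[b bE]|[w]].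
    (* Modulo the image of [h], the pair [(x, z)] equals [(x - al e, 0)], since
       [h e = (al e, z)]. *)
    have [e eE] := pS b; exists (pi (x - al e)); rewrite i'E /= uE.
    apply/eqP; rewrite -subr_eq0 -linearB; apply/eqP/qE; exists (- e).
    rewrite hE /= !linearN eE bE; congr (_, _) => /=; last by rewrite sub0r.
    by rewrite addrAC subrr sub0r.
  have [v <-] := piS w; rewrite i'E => qv.
  have := p'E (x, z); rewrite -qv /= p'E uE /= => <-; exact: linear0.
- have [x <-] := piS' y; exists (q (0, x)); by rewrite p'E.
Qed.

(** Horseshoe lemma: lifting [pi'] through [p] gives a surjection from [P * P'] onto [E], whose
    kernel is [E']. *)
Lemma syzygy_horseshoe A E B A' B' (i : {linear A -> E}) (p : {linear E -> B}) :
    short_exact i p ->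
    syzygy_of A' A -> syzygy_of B' B ->
  exists E' (i' : {linear A' -> E'}) (p' : {linear E' -> B'}),
    short_exact i' p' /\ syzygy_of E' E.
Proof.
move=> [iI iE pS] [P [f [pi [pP [fI fE piS]]]]] [P' [f' [pi' [pP' [fI' fE' piS']]]]].
have [l lE] := pP' _ _ p pS pi'.
pose t : {linear (P * P')%type -> E} := (i \o pi \o fst) \+ (l \o snd).
have [E' [k [kI kE]]] := kernel_exists t.
have pt z : p (t z) = pi' z.2.
  by rewrite /= linearD -[RHS]lE (iE _).2 ?add0r //; exists (pi z.1).
have [u uE] := linear_pair_exists f (GRing.null_fun P' : {linear A' -> P'}).
have [|i' i'E] := factor_injective (h := u) kI.
  move=> x; apply/kE; rewrite uE /= (fE _).2 ?linear0 ?addr0 //; by exists x.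
have [|p' p'E] := factor_injective (h := snd \o k) fI'.
  by move=> x; apply/fE'; rewrite /= -pt (kE _).2 ?linear0 //; exists x.
exists E', i', p'; split; last first.
  exists (P * P')%type, k, t; split; first exact: projective_prod.
  split=> // e; have [y yE] := piS' (p e).
  have [|a aE] := (iE (e - l y)).1; first by rewrite linearB [p (l _)]lE yE subrr.
  by have [x xE] := piS a; exists (x, y); rewrite /= xE aE subrK.
split=> [x y xy|y|y].
- by apply: fI; have := i'E x; rewrite xy i'E !uE => -[].
- split=> [y0|[x <-]]; last by apply: fI'; rewrite p'E /= i'E uE linear0.
  have y2 : (k y).2 = 0 by have := p'E y; rewrite y0 linear0.
  have y1 : pi (k y).1 = 0.
    have : t (k y) = 0 by apply/kE; exists y.
    by rewrite /= y2 linear0 addr0 -[0](linear0 i) => /iI.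
  have [a aE] := (fE _).1 y1; exists a.
  by apply: kI; rewrite [RHS]surjective_pairing y2 i'E uE aE.
- have [a aE] : exists a, i a = l (f' y).
    by apply/iE; rewrite [p _]lE; apply/fE'; exists y.
  have [x xE] := piS a.
  have [|z zE] := (kE (- x, f' y)).1; first by rewrite /= !linearN xE aE addNr.
  by exists z; apply: fI'; rewrite p'E /= zE.
Qed.

(** Here [N = P / s(M)] and [C = N * M]; the embedding of [E] in [C] is [e |-> (g (j e), r e)]. *)
Lemma cosyzygy_retract M E E' (s : {linear M -> E}) (r : {linear E -> M}) :
    cancel s r -> syzygy_of E E' ->
  exists N C (i : {linear E -> C}) (p : {linear C -> E'}) (s' : {linear N -> C})
      (r' : {linear C -> N}), [/\ short_exact i p, cancel s' r' & syzygy_of M N].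
Proof.
move=> sK [P [j [q [pP [jI jE qS]]]]].
have [N [g [gE gS]]] := cokernel_exists (j \o s).
have [h hE] := linear_pair_exists (g \o j) r.
have [|q' q'E] := factor_surjective (h := q) gS.
  by move=> x /gE[m <-]; apply/jE; exists (s m).
have [s' s'E] := linear_pair_exists idfun (GRing.null_fun M : {linear N -> M}).
exists N, (N * M)%type, h, (q' \o fst), s', fst; split.
- split=> [|[c m]|y].
  + apply: linear_injective => e; rewrite hE /= => -[/gE[m /= /jI <-]].
    by rewrite sK => ->; rewrite linear0.
  + rewrite /=; have [x <-] := gS c; rewrite q'E; split=> [/jE[e eE]|[e]].
      (* Elements of [s(M)] are killed by [g \o j], so the second coordinate can be corrected to [m]
         without changing the first. *)
      exists (e + s (m - r e)); rewrite hE /=.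
      have gs : g (j (s (m - r e))) = 0 by apply/gE; exists (m - r e).
      by rewrite linearD linearD gs addr0 eE linearD sK addrC subrK.
    rewrite hE /= => -[gje _].
    by rewrite -q'E -gje q'E; apply/jE; exists e.
  + by have [x <-] := qS y; exists (g x, 0); rewrite /= q'E.
- by move=> x; rewrite s'E.
exists P, (j \o s), g; split=> //; split=> // x y /jI.
exact: can_inj sK _ _.
Qed.

(** Here [N] is the kernel of [r \o q], which [q] maps onto the kernel of [r]. As [E] is the direct
    sum of that kernel and [s(M)], the module [N * M] surjects onto [E] with kernel [E']. *)
Lemma syzygy_retract M E E' (s : {linear M -> E}) (r : {linear E -> M}) :
    cancel s r -> syzygy_of E' E ->
  exists N C (i : {linear E' -> C}) (p : {linear C -> E}) (s' : {linear N -> C})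
      (r' : {linear C -> N}), [/\ short_exact i p, cancel s' r' & syzygy_of N M].
Proof.
move=> sK [P [j [q [pP [jI jE qS]]]]].
have [N [k [kI kE]]] := kernel_exists (r \o q).
have qj x : q (j x) = 0 by apply/jE; exists x.
have [|h hE] := factor_injective (h := j) kI.
  by move=> x; apply/kE; rewrite /= qj linear0.
have [i iE] := linear_pair_exists h (GRing.null_fun M : {linear E' -> M}).
have [s' s'E] := linear_pair_exists idfun (GRing.null_fun M : {linear N -> M}).
have rqk x : r (q (k x)) = 0 by apply/(kE (k x)); exists x.
exists N, (N * M)%type, i, ((q \o k \o fst) \+ (s \o snd)), s', fst; split.
- split=> [x y|[x m]|e].
  + by rewrite !iE => -[xy]; apply: jI; rewrite -!hE xy.
  + rewrite /=; split=> [xm|[y]]; last first.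
      by rewrite iE => -[<- <-]; rewrite hE qj linear0 addr0.
    have m0 : m = 0.
      by have := congr1 r xm; rewrite linearD rqk add0r sK linear0.
    have [|y yE] := (jE (k x)).1; first by rewrite -xm m0 linear0 addr0.
    by exists y; rewrite iE m0; congr (_, _); apply: kI; rewrite hE.
  + have [x xE] := qS (e - s (r e)).
    have [|z zE] := (kE x).1; first by rewrite /= xE linearB sK subrr.
    by exists (z, r e); rewrite /= zE xE subrK.
- by move=> x; rewrite s'E.
exists P, k, (r \o q); split=> //; split=> // m.
by have [x xE] := qS (s m); exists x; rewrite /= xE.
Qed.

End Syzygies.

(** * The closure of the Gorenstein projectives under extensions and retracts *)

Section GorensteinProjectives.
Variable R : comPzRingType.
Implicit Types A B C E F G M N P Q U : lmodType R.

Definition totally_acyclic (P : int -> lmodType R)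
    (d : forall i, {linear P (i + 1) -> P i}) : Prop :=
  [/\ forall i, projective (P i),
      forall i, exact_at (d (i + 1)) (d i)
    & forall Q : lmodType R, projective Q ->
        forall i, contra_hom_exact_at Q (d (i + 1)) (d i)].

(** Generators are the images of differentials in every degree, so that their syzygies and
    cosyzygies are again generators without reindexing the complex. *)
Inductive gp_closure : lmodType R -> Prop :=
| gp_closure_cycle (P : int -> lmodType R) (d : forall i, {linear P (i + 1) -> P i}) i M
    (j : {linear M -> P i}) of totally_acyclic d & injective j &
    (forall y, (exists m, j m = y) <-> (exists x, d i x = y)) : gp_closure M
| gp_closure_ext A E B (i : {linear A -> E}) (p : {linear E -> B}) of
    short_exact i p & gp_closure A & gp_closure B : gp_closure E
| gp_closure_retract M E (s : {linear M -> E}) (r : {linear E -> M}) of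
    cancel s r & gp_closure E : gp_closure M.

Lemma corestriction_exists A B M (d : {linear A -> B}) (j : {linear M -> B}) :
    injective j -> (forall y, (exists m, j m = y) <-> (exists x, d x = y)) ->
  exists p : {linear A -> M}, (forall x, j (p x) = d x) /\ surjective_map p.
Proof.
move=> jI jE; have [|p pE] := factor_injective (h := d) jI.
  by move=> x; apply/jE; exists x.
exists p; split=> // m; have [|x xE] := (jE (j m)).1; first by exists m.
by exists x; apply: jI; rewrite pE.
Qed.

Lemma gp_closure_extension_property M Q :
  gp_closure M -> projective Q -> extension_property M Q.
Proof.
move=> XM pQ; elim: XM => {M}
  [P d i M j [pP dE dQ] jI jE|A E B i p ip _ eA _ eB|M E s r sK _ eE].
- have [p [pE pS]] := corestriction_exists jI jE.
  have dp : exact_at (d (i + 1)) p.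
    move=> y; rewrite -dE -pE.
    by split=> [->|/eqP]; rewrite ?linear0 // -(linear0 j) => /eqP/jI.
  apply: extension_property_presentation (pP _) pS dp _ (dQ Q pQ (i + 1)) => x.
  by apply/dE; exists x.
- exact: extension_property_ext ip eA eB.
- exact: extension_property_retract sK eE.
Qed.

(** Induction on the closure. A cosyzygy of a retract is found only as a retract of an extension,
    hence the need to close under both operations at once. *)
Lemma gp_closure_cosyzygy M : gp_closure M ->
  exists N, gp_closure N /\ syzygy_of M N.
Proof.
elim=> {M} [P d i M j dA jI jE
  |A E B i p ip _ [A' [XA' AA']] XB [B' [XB' BB']]|M E s r sK XE [E' [XE' EE']]].
(* Writing the degree as [k + 1] makes [P (k + 1)] the source of [d k]; the cosyzygy is the image of
   [d k]. *)
- rewrite -(subrK 1 i) in j jI jE; move: (i - 1) j jI jE => k j jI jE.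
  have [||N [j' [j'I j'E]]] := @submodule_exists _ _ (fun y => exists x, d k x = y).
  + by exists 0; rewrite linear0.
  + by move=> a u v [x <-] [y <-]; exists (a *: x + y); rewrite linearP.
  have [p [pE pS]] := corestriction_exists j'I j'E.
  exists N; split; first exact: gp_closure_cycle dA j'I j'E.
  have [pP dE _] := dA.
  exists (P (k + 1)), j, p; split=> //; split=> // y.
  rewrite jE -dE -pE.
  by split=> [->|/eqP]; rewrite ?linear0 // -(linear0 j') => /eqP/j'I.
- have [|E' [i' [p' [ip' EE']]]] := cosyzygy_horseshoe ip _ AA' BB'.
    by move=> Q; apply: gp_closure_extension_property.
  by exists E'; split=> //; apply: gp_closure_ext ip' XA' XB'.
- have [N [C [i [p [s' [r' [ip sK' MN]]]]]]] := cosyzygy_retract sK EE'.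
  exists N; split=> //; apply: gp_closure_retract sK' _.
  exact: gp_closure_ext ip XE XE'.
Qed.

Lemma gp_closure_syzygy M : gp_closure M ->
  exists N, gp_closure N /\ syzygy_of N M.
Proof.
elim=> {M} [P d i M j dA jI jE
  |A E B i p ip _ [A' [XA' AA']] XB [B' [XB' BB']]|M E s r sK XE [E' [XE' EE']]].
- have [pP dE _] := dA.
  have [p [pE pS]] := corestriction_exists jI jE.
  have [N [k [kI kE]]] := kernel_exists p.
  have pd y : p y = 0 <-> exists x, d (i + 1) x = y.
    rewrite -dE -pE.
    by split=> [->|/eqP]; rewrite ?linear0 // -(linear0 j) => /eqP/jI.
  exists N; split; last by exists (P (i + 1)), k, p.
  by apply: (gp_closure_cycle dA kI) => y; rewrite -kE pd.
- have [E' [i' [p' [ip' EE']]]] := syzygy_horseshoe ip AA' BB'.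
  by exists E'; split=> //; apply: gp_closure_ext ip' XA' XB'.
- have [N [C [i [p [s' [r' [ip sK' MN]]]]]]] := syzygy_retract sK EE'.
  exists N; split=> //; apply: gp_closure_retract sK' _.
  exact: gp_closure_ext ip XE' XE.
Qed.

(** * Splicing complete resolutions *)

(** The differential [P (i + 1) -> P i] is the composite through [Z (i + 1)]. A map to [Q] that
    kills the incoming differential factors through [Z (i + 1)], and extends to [P i] because Ext
    from [Z i] to [Q] vanishes. *)
Lemma Gorenstein_projective_of_syzygies (Z : int -> lmodType R) :
    (forall i, syzygy_of (Z (i + 1)) (Z i)) ->
    (forall i Q, projective Q -> extension_property (Z i) Q) ->
  Gorenstein_projective (Z 0).
Proof.
move=> /choice[P ZP] Zext.
have [f fP] := all_sig (fun i => cid (ZP i)); have [p pfp] := all_sig (fun i => cid (fP i)).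
have pP i := (pfp i).1; have fI i := (pfp i).2.
exists P, (fun i => f i \o p (i + 1)); split=> //.
- move=> i y /=; have [fiI fiE _] := fI i; have [_ fE pS] := fI (i + 1).
  split=> [|[x <-]].
    rewrite -(linear0 (f i)) => /fiI/fE[z <-].
    have [_ _ pS'] := fI (i + 1 + 1); have [x <-] := pS' z.
    by exists x.
  by rewrite (fE _).2 ?linear0 //; eexists; reflexivity.
- move=> Q pQ i h; have [_ fE pS] := fI (i + 1); split=> [h0|[k kE] x].
    have [|h' h'E] := factor_surjective (h := h) pS.
      move=> x /fE[z <-]; have [_ _ pS'] := fI (i + 1 + 1).
      by have [y <-] := pS' z; exact: h0.
    have [k kE] := Zext i Q pQ _ _ _ _ (fI i) h'.
    by exists k => x; rewrite /= kE h'E.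
  rewrite /= -kE /= (fE _).2 ?linear0 //; eexists; reflexivity.
(* The index [-1 + 1] computes to [0], so [f (-1)] embeds [Z 0] in [P (-1)]. *)
- have [f1I f1E _] := fI (-1); have [_ _ pS] := fI 0.
  exists (f (-1)); split=> // y; split=> [[m <-]|[x <-]].
    by have [x <-] := pS m; exists x.
  by exists (p 0 x).
Qed.

Lemma gp_closure_Gorenstein M : gp_closure M -> Gorenstein_projective M.
Proof.
move=> XM.
(* Bundling membership with the module lets the chosen syzygies and cosyzygies be iterated. *)
pose T := {N : lmodType R | gp_closure N}.
have /choice[up upE] : forall N : T, exists N' : T, syzygy_of (sval N) (sval N').
  by move=> [N XN]; have [N' [XN' NN']] := gp_closure_cosyzygy XN; exists (exist _ N' XN').
have /choice[down downE] : forall N : T, exists N' : T, syzygy_of (sval N') (sval N).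
  by move=> [N XN]; have [N' [XN' NN']] := gp_closure_syzygy XN; exists (exist _ N' XN').
(* [Negz n] is [-(n + 1)], so it receives [n + 1] cosyzygies; the cases below are [i >= 0], [i = -1]
   and [i <= -2]. *)
pose Z (i : int) : T := match i with
  | Posz n => iter n down (exist _ M XM) | Negz n => iter n.+1 up (exist _ M XM) end.
apply: (@Gorenstein_projective_of_syzygies (fun i => sval (Z i))) => [[n|[|n]]|i Q].
- rewrite -[_ + 1]/(Posz (n + 1)) addn1; exact: downE.
- exact: upE.
- have -> : Negz n.+1 + 1 = Negz n by rewrite !NegzE -addn1 PoszD opprD subrK.
  exact: upE.
- by apply: gp_closure_extension_property; exact: (svalP (Z i)).
Qed.

Lemma Gorenstein_gp_closure M : Gorenstein_projective M -> gp_closure M.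
Proof.
move=> [P [d [pP dE dQ [j [jI jE]]]]].
exact: (@gp_closure_cycle P d (-1) M j).
Qed.

(** The constant family [F] is spliced from the split sequences [F -> F * F -> F]. Every extension
    of [F] splits, so maps extend along the resulting retraction. *)
Lemma projective_Gorenstein F : projective F -> Gorenstein_projective F.
Proof.
move=> pF; apply: (@Gorenstein_projective_of_syzygies (fun=> F)) => [_|_ Q _].
  have [u uE] := linear_pair_exists idfun (GRing.null_fun F : {linear F -> F}).
  exists (F * F)%type, u, snd; split; first exact: projective_prod.
  split=> [x y|[x y]|y]; first by rewrite !uE => -[].
    by split=> [/= ->|[z]]; [exists x; rewrite uE | rewrite uE => -[_ <-]].
  by exists (0, y).
move=> A B i p [iI iE pS] f.
have [s sE] := pF _ _ p pS idfun.
have [|r rE] := factor_injective (h := idfun \- (s \o p)) iI.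
  by move=> x; apply/iE; rewrite /= linearB [p (s _)]sE subrr.
exists (f \o r) => x; congr (f _); apply: iI; rewrite rE /=.
by have -> : p (i x) = 0; [apply/iE; exists x | rewrite linear0 subr0].
Qed.

(** * Pure projectives and the double orthogonal *)

(** Iterated syzygies of [M] splice to a projective resolution. A cocycle on [P 1] factors through
    the first syzygy and then extends to [P 0]. *)
Lemma extension_property_Ext1 M N : extension_property M N -> Ext1_vanishes M N.
Proof.
move=> eMN.
have /choice[down downE] : forall A, exists B : lmodType R, syzygy_of B A.
  move=> A; have [F [e [pF eS]]] := projective_epi_exists A.
  by have [K [k [kI kE]]] := kernel_exists e; exists K, F, k, e.
pose Z n := iter n down M.
have /choice[P ZP] : forall n, exists P : lmodType R, exists (i : {linear Z n.+1 -> P})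
    (p : {linear P -> Z n}), projective P /\ short_exact i p.
  by move=> n; exact: downE.
have [f fP] := all_sig (fun n => cid (ZP n)); have [p pfp] := all_sig (fun n => cid (fP n)).
have fE n : exact_at (f n) (p n) by have [_ []] := pfp n.
have fI n : injective (f n) by have [_ []] := pfp n.
have pS n : surjective_map (p n) by have [_ []] := pfp n.
have pf n x : p n (f n x) = 0 by apply/fE; exists x.
exists P, (fun n => f n \o p n.+1), (p 0%N); split.
  split=> [n|n y|y|//]; first exact: (pfp n).1.
    split=> [|[x <-]] /=; last by rewrite pf linear0.
    rewrite -(linear0 (f n)) => /fI/fE[z <-].
    by have [x <-] := pS _ z; exists x.
  split=> [/(fE 0%N)[z <-]|[x <-]]; last exact: (pf 0%N).
  by have [x <-] := pS _ z; exists x.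
move=> h; split=> [h0|[k kE] x]; last by rewrite /= -kE /= pf !linear0.
have [|h' h'E] := factor_surjective (h := h) (pS 1%N).
  by move=> x /fE[z <-]; have [y <-] := pS _ z; exact: h0.
have [k kE] := eMN _ _ _ _ (pfp 0%N).2 h'.
by exists k => x; rewrite /= kE h'E.
Qed.

(* The pushout of an extension of M along a map into N is an extension of M by N;
   it is pure because Ext^1 into N vanishes on X, hence it splits. *)
Lemma pure_projective_left_orth (X : lmodType R -> Prop) M :
  pure_projective X M -> left_orth (right_orth X) M.
Proof.
move=> pureM N XN.
apply: extension_property_Ext1 => A B i p [iI iE pS] f.
have pi0 x : p (i x) = 0 by apply/iE; exists x.
(* The pushout [W] is the cokernel of [a |-> (f a, - i a)]; [w] and [v] are the inclusions of [N]
   and [B] in [N * B]. *)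
have [u uE] := linear_pair_exists f (\0 \- i).
have [W [q [qE qS]]] := cokernel_exists u.
have [w wE] := linear_pair_exists idfun (GRing.null_fun B : {linear N -> B}).
have [v vE] := linear_pair_exists (GRing.null_fun N : {linear B -> N}) idfun.
have qi x : q (v (i x)) = q (w (f x)).
  apply/eqP; rewrite -subr_eq0 -linearB; apply/eqP/qE; exists (- x).
  rewrite uE vE wE /= linearN.
  by congr (_, _); rewrite /= ?linearN ?opprK ?sub0r ?subr0 ?add0r.
have [|p' p'E] := factor_surjective (h := p \o snd) qS.
  by move=> x /qE[a <-]; rewrite uE /= sub0r linearN pi0 oppr0.
have p'S : surjective_map p'.
  by move=> m; have [b <-] := pS m; exists (q (0, b)); rewrite p'E.
have ip' : short_exact (q \o w) p'.
  split=> // [|y].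
    apply: linear_injective => n /= /qE[a]; rewrite uE wE /= sub0r => -[<-].
    by move=> /eqP; rewrite oppr_eq0 -(linear0 i) => /eqP/iI->; rewrite linear0.
  have [[n b] <-] := qS y; rewrite p'E /=; split=> [/iE[a ab]|[n' n'E]].
    exists (n + f a); rewrite linearD linearD -qi -linearD.
    by rewrite wE vE ab; congr (q (_, _)); rewrite /= ?addr0 ?add0r.
  by have := p'E (n, b); rewrite -n'E p'E wE /= linear0.
have [|_ _ /(_ idfun)[s sE]] := pureM _ _ _ _ _ (conj ip' _).
  by move=> U XU; apply: extension_property_hom_surjective ip' _;
     apply/Ext1_vanishes_extension/XN.
have [qwI qwE _] := ip'.
(* Subtracting the section [s] moves the image of [B] into the kernel of [p'], which is [N]; on [A]
   the result is [f] by [qi]. *)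
have [|r rE] := factor_injective (h := (q \o v) \- (s \o p)) qwI.
  by move=> b; apply/qwE; rewrite /= linearB [p' (s _)]sE p'E vE subrr.
by exists r => a; apply: qwI; rewrite rE /= pi0 linear0 subr0 qi.
Qed.

End GorensteinProjectives.

Theorem proposition2p5 (R : comPzRingType) :
  (precovering (@Gorenstein_projective R) ->
   forall M : lmodType R,
     left_orth (right_orth (@Gorenstein_projective R)) M ->
     has_precover (@Gorenstein_projective R) M)
  /\
  ((forall M : lmodType R,
      left_orth (right_orth (@Gorenstein_projective R)) M ->
      has_precover (@Gorenstein_projective R) M) ->
   forall M : lmodType R,
     Gorenstein_projective M <->
     pure_projective (@Gorenstein_projective R) M).
Proof.
split=> [preC M _|preC M]; first exact: preC.
(* For Gorenstein projective [M], surjectivity on Hom is purity tested at [M] itself; the rest is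
   left exactness of Hom. *)
split=> [GM A B C i p [[iI iE pS] pureU]|pureM].
  split; last exact: pureU.
  - by move=> f f' ff' x; apply: iI; exact: ff'.
  - move=> g; split=> [pg0|[f fg] x]; last by rewrite /= -fg; apply/iE; exists (f x).
    have [|f fE] := factor_injective (h := g) iI; last by exists f.
    by move=> x; apply/iE/pg0.
have [G [phi [GG phiU]]] := preC M (pure_projective_left_orth pureM).
have phiS : surjective_map phi.
  have [F [e [pF eS]]] := projective_epi_exists M => m.
  have [g gE] := phiU F (projective_Gorenstein pF) e.
  by have [x <-] := eS m; exists (g x); exact: gE.
have [K [k [kI kE]]] := kernel_exists phi.
(* The lifting property of the precover is exactly purity of its kernel sequence; lifting the
   identity of [M] splits it. *)
have [_ _ /(_ idfun)[s sE]] := pureM _ _ _ _ _ (conj (And3 kI kE phiS) phiU).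
apply: gp_closure_Gorenstein.
exact: gp_closure_retract sE (Gorenstein_gp_closure GG).
Qed.
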